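(* Let $G$ be a $k$-adjacency dimensional graph of order $n\ge 2$. Then $\operatorname{adim}_k(G)=n$ if and only if $\mathcal{C}_k(G)=V(G)$.
   Context: All graphs are finite and simple. For a graph $G=(V,E)$, $d_{G,2}(x,y)=\min\{d_G(x,y),2\}$ where $d_G$ is the shortest-path distance ($\infty$ between different components). For distinct $x,y\in V$, $\mathcal{C}_G(x,y)=\{z\in V:\ d_{G,2}(x,z)\neq d_{G,2}(y,z)\}$. A set $S\subseteq V$ is a $k$-adjacency generator if $|S\cap\mathcal{C}_G(x,y)|\ge k$ for all distinct $x,y$; a minimum one is a $k$-adjacency basis, of cardinality $\operatorname{adim}_k(G)$. $G$ is $k$-adjacency dimensional if $k$ is the largest integer for which a $k$-adjacency generator exists. Define $\mathcal{C}_k(G)=\bigcup\{\mathcal{C}_G(x,y):\ x\ne y,\ |\mathcal{C}_G(x,y)|=k\}$. *)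

(* Defs.v *)
From mathcomp Require Import all_boot.

Set Implicit Arguments.
Unset Strict Implicit.
Unset Printing Implicit Defensive.

(* A finite simple graph is a symmetric irreflexive relation e on a finType. *)

Definition has_path (T : finType) (e : rel T) (x y : T) (n : nat) : bool :=
  [exists p : n.-tuple T, [&& path e x p, last x p == y & uniq (x :: p)]].

Lemma connect_has_path (T : finType) (e : rel T) (x y : T) :
  connect e x y -> exists n, has_path e x y n.
Proof.
case/connectP=> p ep ->; case/shortenP: ep => q eq uq _; exists (size q).
by apply/existsP; exists (in_tuple q); rewrite eq eqxx uq.
Qed.

(* None stands for an infinite distance. *)
Definition dist (T : finType) (e : rel T) (x y : T) : option nat :=
  match @idP (connect e x y) with
  | ReflectT cxy => Some (ex_minn (connect_has_path cxy))
  | ReflectF _ => None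
  end.

Definition dist2 (T : finType) (e : rel T) (x y : T) : nat :=
  if dist e x y is Some n then minn n 2 else 2.

Definition distinguishers (T : finType) (e : rel T) (x y : T) : {set T} :=
  [set z | dist2 e x z != dist2 e y z].

Definition adj_generator (T : finType) (e : rel T) (k : nat) (S : {set T}) :
    bool :=
  [forall x, forall y, (x != y) ==> (k <= #|S :&: distinguishers e x y|)].

(* The default [set: T] is itself a k-adjacency generator as soon as there is
   one, so this is a minimum generator whenever k-adjacency bases exist. *)
Definition adj_basis (T : finType) (e : rel T) (k : nat) : {set T} :=
  [arg min_(S < [set: T] | adj_generator e k S) #|S|].

Definition adim (T : finType) (e : rel T) (k : nat) : nat :=
  #|adj_basis e k|.

Definition adj_dimensional (T : finType) (e : rel T) (k : nat) : Prop :=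
  (exists S, adj_generator e k S) /\
  (forall k', (exists S, adj_generator e k' S) -> k' <= k).

Definition distinguishers_card (T : finType) (e : rel T) (k : nat) : {set T} :=
  \bigcup_(p : T * T | (p.1 != p.2) && (#|distinguishers e p.1 p.2| == k))
    distinguishers e p.1 p.2.

(* Main.v *)
(* A vertex v lies in C_k(G) exactly when every k-adjacency generator must
   contain it: if |C(x, y)| = k, every generator contains C(x, y), while
   V \ {v} is a generator as soon as every C(x, y) containing v has more than
   k elements. *)

Require Import Defs.
From mathcomp Require Import all_boot.

Lemma adj_generatorP (T : finType) (e : rel T) (k : nat) (S : {set T}) :
  reflect (forall x y, x != y -> k <= #|S :&: distinguishers e x y|)
          (adj_generator e k S).
Proof.
apply: (iffP forallP) => [gen x y xy | gen x].
  by have /forallP/(_ y)/implyP := gen x; apply.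
by apply/forallP => y; apply/implyP; apply: gen.
Qed.

Lemma adj_generatorS (T : finType) (e : rel T) (k : nat) (S S' : {set T}) :
  S \subset S' -> adj_generator e k S -> adj_generator e k S'.
Proof.
move=> SS' /adj_generatorP gen; apply/adj_generatorP => x y xy.
exact: leq_trans (gen x y xy) (subset_leq_card (setSI _ SS')).
Qed.

(** A distinguishing set of exactly [k] elements meets [S] in at least [k] of them, hence in all of
    them. *)
Lemma distinguishers_card_sub (T : finType) (e : rel T) (k : nat)
    (S : {set T}) :
  adj_generator e k S -> distinguishers_card e k \subset S.
Proof.
move=> /adj_generatorP gen.
apply/bigcupsP => -[x y] /= /andP[xy /eqP card_xy].
apply/setIidPr/eqP.
by rewrite eqEcard subsetIr card_xy gen.
Qed.

(** Deleting [v] costs a distinguishing set at most one element, and those containing [v] have one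
    to spare. *)
Lemma adj_generatorC1 (T : finType) (e : rel T) (k : nat) (v : T) :
  adj_generator e k [set: T] -> v \notin distinguishers_card e k ->
  adj_generator e k [set~ v].
Proof.
move=> /adj_generatorP gen v_notin; apply/adj_generatorP => x y xy.
have := gen x y xy; rewrite setTI setIC -setDE leq_eqVlt => card_xy.
have [v_xy | v_xy] := boolP (v \in distinguishers e x y); last first.
  by rewrite (cardsD1 v) (negPf v_xy) -leq_eqVlt in card_xy.
rewrite (cardsD1 v) v_xy add1n ltnS in card_xy.
(* Equality would make this a distinguishing set of size [k] through [v]. *)
case/orP: card_xy => // /eqP card_xy; case/negP: v_notin.
apply/bigcupP; exists (x, y) => //=.
by rewrite xy (cardsD1 v) v_xy add1n card_xy eqxx.
Qed.

Theorem theorem13 (T : finType) (e : rel T) (k : nat)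
    (e_sym : symmetric e) (e_irr : irreflexive e)
    (order_ge2 : 2 <= #|T|) (k_dim : adj_dimensional e k) :
  adim e k = #|T| <-> distinguishers_card e k = [set: T].
Proof.
(* The default value in [adj_basis] must itself be a generator for [arg_minnP] to apply. *)
have [[S0 /(adj_generatorS _ _ _ _ _ (subsetT S0)) genT] _] := k_dim.
rewrite /adim /adj_basis; case: arg_minnP => // S genS minS; split=> [cardS|].
  apply/eqP; rewrite -subTset; apply/subsetP => v _.
  apply/negPn/negP => /(adj_generatorC1 _ _ _ _ genT)/minS.
  (* Minimality would give [#|T| <= #|T|.-1], which is absurd as [T] is nonempty. *)
  by rewrite cardsC1 cardS leqNgt prednK ?leqnn // ltnW.
have := distinguishers_card_sub _ _ _ _ genS.
by move=> + cover; rewrite cover subTset => /eqP ->; rewrite cardsT.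
Qed.
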